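(* Suppose that $\mathcal{M}\subset\mathcal{J}^2$ is a constant coefficient monotonicity cone subequation that admits a strict approximator on a bounded domain $\Omega\subset\mathbb{R}^n$. Then the zero maximum principle holds for $\widetilde{\mathcal{M}}$ on $\overline{\Omega}$; that is, $$z\le0\ \text{on }\partial\Omega\quad\Longrightarrow\quad z\le0\ \text{on }\Omega$$ for all $z\in\mathrm{USC}(\overline{\Omega})$ that are $\widetilde{\mathcal{M}}$-subharmonic on $\Omega$. If, in addition, the strict approximator $\psi$ satisfies $\psi\equiv-\infty$ on $\partial\Omega\setminus\partial^-\Omega$ for some $\partial^-\Omega\subset\partial\Omega$, then the zero maximum principle holds in the following form: $$z\le0\ \text{on }\partial^-\Omega\quad\Longrightarrow\quad z\le0\ \text{on }\Omega$$ for all $z\in\mathrm{USC}(\overline{\Omega})$ that are $\widetilde{\mathcal{M}}$-subharmonic on $\Omega$.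
   Context: $\mathcal{S}(n)$ is the space of real symmetric $n\times n$ matrices with its usual partial order and $\mathcal{J}^2=\mathbb{R}\times\mathbb{R}^n\times\mathcal{S}(n)$. $\mathrm{USC}$ denotes upper semicontinuous functions with values in $[-\infty,+\infty)$. A (constant coefficient) monotonicity cone subequation is a nonempty closed convex cone $\mathcal{M}\subset\mathcal{J}^2$ with vertex at the origin such that $\mathcal{M}=\overline{\operatorname{int}\mathcal{M}}$ and: (P) $(r,p,A)\in\mathcal{M}\Rightarrow(r,p,A+P)\in\mathcal{M}$ for all $P\ge0$; (N) $(r,p,A)\in\mathcal{M}\Rightarrow(r+s,p,A)\in\mathcal{M}$ for all $s\le0$. Its Dirichlet dual is $\widetilde{\mathcal{M}}=(-\operatorname{int}\mathcal{M})^c$ (complement in $\mathcal{J}^2$). For $z$ upper semicontinuous, $J^{2,+}_xz=\{(\varphi(x),D\varphi(x),D^2\varphi(x)):\varphi\text{ is }C^2\text{ near }x,\ z\le\varphi\text{ near }x\text{ with equality at }x\}$; $z$ is $\widetilde{\mathcal{M}}$-subharmonic on $\Omega$ if $J^{2,+}_xz\subset\widetilde{\mathcal{M}}$ for all $x\in\Omega$. A strict approximator for $\mathcal{M}$ on $\Omega$ is a function $\psi\in\mathrm{USC}(\overline{\Omega})\cap C^2(\Omega)$ with $(\psi(x),D\psi(x),D^2\psi(x))\in\operatorname{int}\mathcal{M}$ for all $x\in\Omega$. *)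

(* Defs.v *)
From HB Require Import structures.
From mathcomp Require Import all_boot all_order all_algebra.
From mathcomp Require Import all_classical all_reals all_analysis.
Set Implicit Arguments.
Unset Strict Implicit.
Unset Printing Implicit Defensive.
Import Order.TTheory GRing.Theory Num.Theory numFieldNormedType.Exports.
Local Open Scope classical_set_scope.
Local Open Scope ring_scope.

(* The space of symmetric matrices is a type of its own, so that the library's
   interior, closure and complement, used on sets of 2-jets, are relative to
   R x R^n x S(n), and not to R x R^n x 'M_n where such sets have no interior. *)
Section SymmetricMatrices.
Context (R : realType) (n : nat).

Definition is_symmx : {pred 'M[R]_n} := [pred A | A^T == A].

Fact is_symmx_submod : submod_closed is_symmx.
Proof.
split=> [|a A B]; first by rewrite inE /= trmx0.
by rewrite !inE /= => /eqP AT /eqP BT; rewrite linearP /= AT BT.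
Qed.

HB.instance Definition _ :=
  GRing.isSubmodClosed.Build R 'M[R]_n is_symmx is_symmx_submod.

Record symmx := SymMx { mx_of_symmx :> 'M[R]_n; _ : mx_of_symmx \in is_symmx }.

HB.instance Definition _ := [isSub for mx_of_symmx].
HB.instance Definition _ := [Choice of symmx by <:].
HB.instance Definition _ := [SubChoice_isSubLmodule of symmx by <:].
HB.instance Definition _ :=
  PseudoMetric.copy symmx (initial_topology mx_of_symmx).

Definition psd (P : symmx) := forall v : 'rV[R]_n, 0 <= (v *m P *m v^T) 0 0.

End SymmetricMatrices.

Notation jet2 R n := (R * 'rV[R]_n * symmx R n)%type.

Section Subequations.
Context (R : realType) (n : nat).
Implicit Types M : set (jet2 R n).

Definition monotonicity_cone_subequation M :=
  [/\ M !=set0,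
      closed M,
      convex_set (M : set (convex_lmodType (jet2 R n))),
      forall (t : R) (J : jet2 R n), 0 < t -> M J -> M (t *: J) &
   [/\ M = closure (interior M),
      forall r p A P, psd P -> M (r, p, A) -> M (r, p, A + P) &
      forall r p A (s : R), s <= 0 -> M (r, p, A) -> M (r + s, p, A)]].

Definition dirichlet_dual M : set (jet2 R n) := ~` (-%R @` interior M).

End Subequations.

Section Jets.
Context (R : realType) (n : nat).
Implicit Types (phi : 'rV[R]_n -> R) (z : 'rV[R]_n -> \bar R).
Implicit Types (x : 'rV[R]_n) (U K : set 'rV[R]_n).

Definition partial (i : 'I_n) phi : 'rV[R]_n -> R := 'D_(delta_mx 0 i) phi.

Definition gradient phi x : 'rV[R]_n := \row_i partial i phi x.

Definition hessian phi x : 'M[R]_n :=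
  \matrix_(i, j) partial i (partial j phi) x.

(* Meant for open U. *)
Definition C2_on U phi := forall x, U x ->
  [/\ {for x, continuous phi},
      forall i : 'I_n, derivable phi x (delta_mx 0 i) /\
                {for x, continuous (partial i phi)} &
      forall i j : 'I_n, derivable (partial j phi) x (delta_mx 0 i) /\
                  {for x, continuous (partial i (partial j phi))}].

Definition C2_near x phi := exists2 U, open_nbhs x U & C2_on U phi.

(* J = (phi(x), D phi(x), D^2 phi(x)). This is a relation because the symmetry
   of the Hessian, hence the existence of J, is a theorem about C^2 functions. *)
Definition has_jet2 phi x (J : jet2 R n) :=
  [/\ J.1.1 = phi x, J.1.2 = gradient phi x & J.2 = hessian phi x :> 'M[R]_n].

Definition superjet2 z x : set (jet2 R n) :=
  [set J | exists phi, [/\ C2_near x phi,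
                           \forall y \near x, (z y <= (phi y)%:E)%E,
                           z x = (phi x)%:E &
                           has_jet2 phi x J]].

(* z restricted to K is upper semicontinuous with values in [-oo, +oo[; the
   values of z outside K are irrelevant. *)
Definition usc_on K z := forall x, K x ->
  (z x < +oo)%E /\
  forall a : R, (z x < a%:E)%E -> \forall y \near x, K y -> (z y < a%:E)%E.

Definition subharmonic (F : set (jet2 R n)) U z :=
  forall x, U x -> superjet2 z x `<=` F.

Definition strict_approximator (M : set (jet2 R n)) U (psi : 'rV[R]_n -> \bar R) :=
  [/\ usc_on (closure U) psi,
      forall x, U x -> psi x \is a fin_num,
      C2_on U (fine \o psi) &
      forall x, U x -> exists2 J, has_jet2 (fine \o psi) x J & interior M J].

Definition bounded_domain U :=
  [/\ open U, connected U, U !=set0 & bounded_set U].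

Definition boundary U := closure U `\` interior U.

(* The zero maximum principle for F on the closure of U, relative to the part
   G of the boundary. *)
Definition zero_maximum_principle (F : set (jet2 R n)) U G :=
  forall z, usc_on (closure U) z -> subharmonic F U z ->
    (forall x, G x -> (z x <= 0)%E) -> forall x, U x -> (z x <= 0)%E.

End Jets.

(* Main.v *)
Require Import Defs.
From mathcomp Require Import all_boot all_order all_algebra.
From mathcomp Require Import all_classical all_reals all_analysis.
From mathcomp Require Import lra.
Import Order.TTheory GRing.Theory Num.Theory numFieldNormedType.Exports.
Local Open Scope classical_set_scope.
Local Open Scope ring_scope.

(** Let [psi] be a strict approximator and [z] a [dirichlet_dual M]-subharmonic
function that is at most 0 on the part of the boundary where [psi] may be
finite.  The idea is to perturb [z] into [w = z + e psi] with a small [e > 0].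

At a point [x] of the open set where [w] has its maximum [c] over that set,
the C^2 function [c - e psi] touches [z] from above, so its 2-jet, which is the
opposite of [e J - (c, 0, 0)] for [J] the 2-jet of [psi], lies in
[dirichlet_dual M]; that is, [e J - (c, 0, 0)] is not interior to [M].  But [J]
is interior to the cone [M], hence so is [e J], and if [c >= 0] then property
(N) makes [e J - (c, 0, 0)] interior as well ([interior_cone_sub]).  So [c < 0]
at every interior maximum ([interior_max_lt0]).

Suppose now that [z x0 > 0].  As [psi] is bounded above on the compact closure,
by some [b >= 0], a small [e] gives [w x0 > e b].  The upper semicontinuous
function [w] reaches its maximum over the closure ([usc_attains_max]), and this
maximum exceeds [e b >= 0], so by the above it is reached on the boundary.
There, however, either [z <= 0] and [w <= e b], or [psi = -oo] and [w = -oo].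

The statement about the whole boundary is the case where the set of boundary
points with [psi = -oo] prescribed is empty. *)

(** * Upper semicontinuous functions *)

Lemma lte_add_split (R : realType) (u v : \bar R) (a : R) :
  (u < +oo)%E -> (v < +oo)%E -> (u + v < a%:E)%E ->
  exists b : R, (u < b%:E)%E /\ (v < (a - b)%:E)%E.
Proof.
case: u v => [u| |] [v| |] //= _ _.
- rewrite -EFinD lte_fin => uva; exists (u + (a - u - v) / 2).
  by rewrite !lte_fin; split; lra.
- by move=> _; exists (u + 1); rewrite lte_fin ltNyr ltrDl.
- by move=> _; exists (a - (v + 1)); rewrite ltNyr lte_fin; split => //; lra.
- by move=> _; exists 0; rewrite !ltNyr.
Qed.

Lemma usc_on_add (R : realType) (n : nat) (K : set 'rV[R]_n)
    (z w : 'rV[R]_n -> \bar R) :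
  usc_on K z -> usc_on K w -> usc_on K (fun x => z x + w x)%E.
Proof.
move=> uz uw x Kx; have [zx zn] := uz x Kx; have [wx wn] := uw x Kx.
split=> [|a /(lte_add_split _ _ _ _ zx wx) [b [zb wb]]]; first exact: lte_add_pinfty.
apply: filterS2 (zn b zb) (wn (a - b) wb) => y zy wy Ky.
have -> : a = b + (a - b) by lra.
by rewrite EFinD lteD ?zy ?wy.
Qed.

Lemma usc_on_scale (R : realType) (n : nat) (K : set 'rV[R]_n)
    (z : 'rV[R]_n -> \bar R) (e : R) : 0 < e ->
  usc_on K z -> usc_on K (fun x => e%:E * z x)%E.
Proof.
move=> e0 uz x Kx; have [zx zn] := uz x Kx.
have scaleE u a : (e%:E * u < a%:E)%E = (u < (a / e)%:E)%E.
  case: u => [u| |]; first by rewrite -EFinM !lte_fin ltr_pdivlMr// mulrC.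
    by rewrite gt0_muley ?lte_fin.
  by rewrite gt0_muleNy ?lte_fin// !ltNyr.
split=> [|a]; last first.
  by rewrite scaleE => /zn; apply: filterS => y zy Ky; rewrite scaleE zy.
case: (z x) zx => [u| |] //= _; first by rewrite -EFinM ltry.
by rewrite gt0_muleNy ?lte_fin.
Qed.

(** Without a maximum, every [x] in [K] has a neighbourhood in [K] on which [z]
stays below some value [z y].  The filter generated by the sets [z y <= z i]
lets the covering form of compactness choose one [i] in [K] that serves for all
points at once, and then [z i < z i]. *)
Lemma usc_attains_max (R : realType) (n : nat) (K : set 'rV[R]_n)
    (z : 'rV[R]_n -> \bar R) :
  compact K -> K !=set0 -> usc_on K z ->
  exists2 x, K x & forall y, K y -> (z y <= z x)%E.
Proof.
move=> /compact_near_coveringP Kc [x0 Kx0] uz; apply: contrapT => nomax.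
have above x : K x -> exists2 y, K y & (z x < z y)%E.
  move=> Kx; apply: contrapT => ny; apply: nomax; exists x => // y Ky.
  by rewrite leNgt; apply/negP => zxy; apply: ny; exists y.
pose F : set_system 'rV[R]_n :=
  [set A | exists2 y, K y & forall i, K i -> (z y <= z i)%E -> A i].
have FF : Filter F.
  split=> [|A B [y Ky yA] [y' Ky' yB]|A B AB [y Ky yA]].
  - by exists x0.
  - have [zyy'|/ltW zy'y] := leP (z y) (z y').
      exists y' => // i Ki zi; split; last exact: yB.
      by apply: yA => //; apply: le_trans zi.
    exists y => // i Ki zi; split; first exact: yA.
    by apply: yB => //; apply: le_trans zi.
  - by exists y => // i Ki zi; apply: AB; exact: yA.
have [|y Ky Hy] := Kc _ F (fun i x => K x -> z x < z i)%E FF.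
  move=> x Kx; have [y Ky zxy] := above x Kx.
  (* A real level strictly in between is needed, because semicontinuity is
     stated with real levels; [z y] is finite as it exceeds [z x]. *)
  have [a xa ay] : exists2 a : R, (z x < a%:E)%E & (a%:E < z y)%E.
    have [zx _] := uz x Kx; have [zy _] := uz y Ky.
    case: (z x) (z y) zx zy zxy => [u| |] [v| |] //= _ _.
      by rewrite lte_fin => uv; exists ((u + v) / 2); rewrite lte_fin; lra.
    by move=> _; exists (v - 1); rewrite ?ltNyr// lte_fin; lra.
  exists ([set x' | K x' -> (z x' < a%:E)%E], [set i | (z y <= z i)%E]).
    split; first exact: (uz x Kx).2.
    by exists y.
  move=> [x' i] /= [x'a yi] Kx'.
  by apply: lt_trans (x'a Kx') _; apply: lt_le_trans ay yi.
by have := Hy y Ky (lexx _) y Ky Ky; rewrite ltxx.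
Qed.

Lemma compact_closure_bounded (R : realType) (n : nat) (U : set 'rV[R]_n) :
  bounded_set U -> compact (closure U).
Proof.
move=> [m [mreal mU]]; apply: bounded_closed_compact; last exact: closed_closure.
exists (m + 1); split; first exact: num_real.
move=> r mr x Ux /=.
have /(_ _ Ux) : closure U `<=` (fun y => `|y|) @^-1` [set t : R | t <= r].
  rewrite [X in _ `<=` X](closure_id _).1; last first.
    apply: (@preimage_closed _ _ (fun y : 'rV[R]_n => `|y|)); last exact: closed_le.
    by move=> y _; exact: norm_continuous.
  by apply: closureS => y Uy /=; apply: (mU r) => //; lra.
by [].
Qed.

(** * Affine images of C^2 functions and of 2-jets *)

Lemma partial_affine (R : realType) (n : nat) (f : 'rV[R]_n -> R) (i : 'I_n)
    (c k : R) (x : 'rV[R]_n) : derivable f x (delta_mx 0 i) ->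
  partial i (fun y => c + k * f y) x = k * partial i f x.
Proof.
move=> df; rewrite /partial.
have -> : (fun y => c + k * f y) = cst c + (k \*: f) by apply/funext.
by rewrite deriveD ?derive_cst ?deriveZ ?add0r//; apply: derivableZ.
Qed.

(** On jets, adding a constant to the function only shifts the value, while
scaling acts on all three components.  The identity for first derivatives is
known on [U] only; openness of [U] makes it an identity near each point, which
is what differentiating it once more requires. *)
Lemma C2_on_affine (R : realType) (n : nat) (U : set 'rV[R]_n)
    (f : 'rV[R]_n -> R) (c k : R) : open U -> C2_on U f ->
  C2_on U (fun y => c + k * f y) /\
  forall x J, U x -> has_jet2 f x J ->
    has_jet2 (fun y => c + k * f y) x ((c, 0, 0) + k *: J).
Proof.
move=> oU fC2; set g := fun y => c + k * f y.
have pg i x : U x -> partial i g x = k * partial i f x.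
  by move=> Ux; apply: partial_affine; have [_ /(_ i)[]] := fC2 x Ux.
have nearg i x : U x -> \near x, (k \*: partial i f) x = partial i g x.
  by move=> Ux; apply: filterS (open_nbhs_nbhs (conj oU Ux)) => y Uy; rewrite pg.
have ppg i j x : U x ->
    partial i (partial j g) x = k * partial i (partial j f) x.
  move=> Ux; rewrite {1}/partial -(near_eq_derive _ (nearg j x Ux)) deriveZ//.
  by have [_ _ /(_ i j)[]] := fC2 x Ux.
have nearpg i j x : U x ->
    \near x, (k \*: partial i (partial j f)) x = partial i (partial j g) x.
  by move=> Ux; apply: filterS (open_nbhs_nbhs (conj oU Ux)) => y Uy; rewrite ppg.
split=> [x Ux|x J Ux [J1 J2 J3]]; last first.
  split=> /=; first by rewrite J1.
    by rewrite add0r J2; apply/rowP => i; rewrite !mxE pg.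
  by rewrite add0r J3; apply/matrixP => i j; rewrite !mxE ppg.
have [fc df ddf] := fC2 x Ux; split.
- apply: continuousD; first exact: cst_continuous.
  by apply: continuousM => //; exact: cst_continuous.
- move=> i; have [dfi cfi] := df i; split.
    by apply: derivableD => //; apply: derivableZ.
  suff : partial i g @ x --> k * partial i f x by rewrite -pg.
  apply: cvg_trans; first exact: (near_eq_cvg (nearg i x Ux)).
  exact: cvgZr.
- move=> i j; have [dfi cfi] := ddf i j; split.
    by apply: near_eq_derivable (nearg j x Ux) _; apply: derivableZ.
  suff : partial i (partial j g) @ x --> k * partial i (partial j f) x.
    by rewrite -ppg.
  apply: cvg_trans; first exact: (near_eq_cvg (nearpg i j x Ux)).
  exact: cvgZr.
Qed.

(** The topology of [symmx] is initial for the inclusion into matrices and comes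
without a topological vector space structure, so continuity of the operations
on the Hessian component is drawn from that of matrices. *)
Lemma jet2_affine_continuous (R : realType) (n : nat) (k : R) (J0 : jet2 R n) :
  continuous (fun J : jet2 R n => k *: (J + J0)).
Proof.
have affc (V : normedModType R) (v0 : V) :
    continuous (fun v : V => k *: (v + v0)).
  by move=> v; apply: cvgZr; apply: cvgD; [exact: cvg_id|exact: cvg_cst].
have sc : continuous (fun A : symmx R n => k *: (A + J0.2)).
  apply: (@continuous_comp_initial _ _ _ (@mx_of_symmx R n)) => A.
  apply: (@continuous_comp _ _ _ (@mx_of_symmx R n)
    (fun B => k *: (B + mx_of_symmx J0.2))).
    exact: initial_continuous.
  exact: affc.
have c1 : continuous (fun J : jet2 R n => k *: (J.1.1 + J0.1.1)).
  move=> J; apply: cvgZr; apply: cvgD; last exact: cvg_cst.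
  exact: (cvg_comp _ _ cvg_fst cvg_fst).
have c2 : continuous (fun J : jet2 R n => k *: (J.1.2 + J0.1.2)).
  move=> J; apply: cvgZr; apply: cvgD; last exact: cvg_cst.
  exact: (cvg_comp _ _ cvg_fst cvg_snd).
have c3 : continuous (fun J : jet2 R n => k *: (J.2 + J0.2)).
  move=> J; apply: (@continuous_comp _ _ _ snd
    (fun A : symmx R n => k *: (A + J0.2))); [exact: cvg_snd|exact: sc].
move=> J; exact: (cvg_pair (cvg_pair (c1 J) (c2 J)) (c3 J)).
Qed.

(** * The maximum principle *)

(** The map sending [K] to [e^-1 (K + (c, 0, 0))] is continuous, takes
[e J - (c, 0, 0)] to [J], and by the cone property and (N) the preimage of [M]
under it is contained in [M]. *)
Lemma interior_cone_sub (R : realType) (n : nat) (M : set (jet2 R n))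
    (e c : R) (J : jet2 R n) :
  monotonicity_cone_subequation M -> 0 < e -> 0 <= c ->
  interior M J -> interior M (e *: J - (c, 0, 0)).
Proof.
move=> [_ _ _ coneM [_ _ negM]] e0 c0 MJ.
have := jet2_affine_continuous _ _ e^-1 (c, 0, 0) (e *: J - (c, 0, 0)) M.
rewrite subrK scalerA mulVf ?gt_eqF// scale1r => /(_ MJ) nbhsM.
suff subM : (fun K : jet2 R n => e^-1 *: (K + (c, 0, 0))) @^-1` M `<=` M.
  exact: filterS subM nbhsM.
move=> -[[r p] A] /= /(coneM e _ e0).
rewrite scalerA divff ?gt_eqF// scale1r => /negM -/(_ (- c)).
by rewrite oppr_le0 => /(_ c0) /=; rewrite addrK !addr0.
Qed.

(** If the maximum [c] were nonnegative, [c - e psi] would be a test function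
for [z] at [x] whose jet is the opposite of an interior point of [M]. *)
Lemma interior_max_lt0 (R : realType) (n : nat) (M : set (jet2 R n))
    (U : set 'rV[R]_n) (z psi : 'rV[R]_n -> \bar R) (e : R) (x : 'rV[R]_n) :
  monotonicity_cone_subequation M -> open U -> strict_approximator M U psi ->
  subharmonic (dirichlet_dual M) U z -> 0 < e -> U x ->
  (forall y, U y -> z y + e%:E * psi y <= z x + e%:E * psi x)%E ->
  (z x < +oo)%E ->
  (z x + e%:E * psi x < 0)%E.
Proof.
move=> Mcone oU [_ psifin psiC2 psiJ] sz e0 Ux xmax zx.
rewrite ltNge; apply/negP => w0.
have psiE y : U y -> psi y = ((fine \o psi) y)%:E.
  by move=> Uy; rewrite /= fineK// psifin.
set f := fine \o psi in psiE psiC2 psiJ.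
have [r zr] : exists r : R, z x = r%:E.
  by move: zx w0; case: (z x) => [r| |] //; exists r.
pose c := r + e * f x.
have c0 : 0 <= c by move: w0; rewrite zr psiE// -EFinM -EFinD lee_fin.
have [phiC2 phiJ] := C2_on_affine _ _ U f c (- e) oU psiC2.
have [J fJ MJ] := psiJ x Ux.
have := sz x Ux ((c, 0, 0) + - e *: J).
apply.
- exists (fun y => c + - e * f y); split.
  + by exists U.
  + apply: filterS (open_nbhs_nbhs (conj oU Ux)) => y Uy.
    have := xmax y Uy; rewrite !psiE// zr.
    case: (z y) => [s| |] //; last by move=> _; rewrite leNye.
    by rewrite -!EFinM -!EFinD !lee_fin /c => h; lra.
  + by rewrite zr /c; congr EFin; lra.
  + exact: phiJ.
- exists (e *: J - (c, 0, 0)); first exact: interior_cone_sub.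
  by rewrite opprB scaleNr.
Qed.

(** The maximum of [z + e psi] over the closure can be neither in [U], by
[interior_max_lt0], nor on the boundary, where the bound on [psi] or the value
[-oo] keeps [z + e psi] too small. *)
Lemma zero_maximum_principle_of_approximator (R : realType) (n : nat)
    (M : set (jet2 R n)) (U G : set 'rV[R]_n) (psi : 'rV[R]_n -> \bar R) :
  monotonicity_cone_subequation M -> bounded_domain U ->
  strict_approximator M U psi ->
  (forall x, (boundary U `\` G) x -> psi x = -oo%E) ->
  zero_maximum_principle (dirichlet_dual M) U G.
Proof.
move=> Mcone [oU _ _ bU] psiA psiG z uz sz zG x0 Ux0.
have [upsi psifin _ _] := psiA.
rewrite leNgt; apply/negP => zx0.
have Kc := compact_closure_bounded _ _ U bU.
have Kx0 : closure U x0 by exact: subset_closure.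
have K0 : closure U !=set0 by exists x0.
have [s psis] : exists s : R, psi x0 = s%:E.
  by exists (fine (psi x0)); rewrite fineK// psifin.
have [r zr] : exists r : R, z x0 = r%:E.
  by have [] := uz x0 Kx0; case: (z x0) zx0 => [r| |]//; exists r.
have [b [b0 sb psib]] : exists b : R, [/\ 0 <= b, s <= b &
    forall x, closure U x -> (psi x <= b%:E)%E].
  have [xm Kxm xmmax] := usc_attains_max _ _ _ psi Kc K0 upsi.
  have [psixm _] := upsi xm Kxm.
  have := xmmax x0 Kx0; rewrite psis.
  case: (psi xm) psixm xmmax => [t| |] //= _ tmax st.
  exists (Num.max 0 t); split; first by rewrite le_max lexx.
    by rewrite le_max; rewrite lee_fin in st; rewrite st orbT.
  by move=> x /tmax xt; apply: le_trans xt _; rewrite lee_fin le_max lexx orbT.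
have r0 : 0 < r by move: zx0; rewrite zr lte_fin.
have d0 : 0 < b - s + 1 by lra.
(* With this [e], [e (b - psi x0) < z x0], which is [e b < z x0 + e psi x0]. *)
pose e := r / (b - s + 1).
have e0 : 0 < e by rewrite divr_gt0.
have er : e * (b - s + 1) = r by rewrite /e divfK// gt_eqF.
have [xm Kxm xmmax] := usc_attains_max _ _ _ _ Kc K0
  (usc_on_add _ _ _ _ _ uz (usc_on_scale _ _ _ _ _ e0 upsi)).
have eb : ((e * b)%:E < z xm + e%:E * psi xm)%E.
  apply: lt_le_trans (xmmax x0 Kx0).
  by rewrite zr psis -EFinM -EFinD lte_fin; lra.
have [Uxm|nUxm] := pselect (U xm).
  have := interior_max_lt0 _ _ _ _ _ _ _ _ Mcone oU psiA sz e0 Uxm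
    (fun y Uy => xmmax y (subset_closure Uy)) (uz xm Kxm).1.
  rewrite ltNge (ltW (le_lt_trans _ eb))// lee_fin.
  by rewrite mulr_ge0// ltW.
have bxm : boundary U xm by split => // /interior_subset.
have [Gxm|nGxm] := pselect (G xm); last first.
  by move: eb; rewrite psiG// gt0_muleNy ?lte_fin// addeC.
move: eb; rewrite ltNge => /negP; apply.
rewrite -[leRHS]add0e; apply: leeD; first exact: zG.
by rewrite (EFinM e b) lee_pmul2l ?lte_fin// psib.
Qed.

Theorem theorem5p1 (R : realType) (n : nat) (M : set (jet2 R n))
    (Omega : set 'rV[R]_n)
    (M_cone : monotonicity_cone_subequation M)
    (Omega_domain : bounded_domain Omega)
    (M_approx : exists psi : 'rV[R]_n -> \bar R,
        strict_approximator M Omega psi) :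
  zero_maximum_principle (dirichlet_dual M) Omega (boundary Omega) /\
  (forall (psi : 'rV[R]_n -> \bar R) (bdm : set 'rV[R]_n),
     strict_approximator M Omega psi ->
     bdm `<=` boundary Omega ->
     (forall x : 'rV[R]_n, (boundary Omega `\` bdm) x -> psi x = -oo%E) ->
     zero_maximum_principle (dirichlet_dual M) Omega bdm).
Proof.
split=> [|psi bdm psiA _ psiG]; last first.
  exact: (zero_maximum_principle_of_approximator R n M Omega bdm psi).
have [psi psiA] := M_approx.
apply: (zero_maximum_principle_of_approximator R n M Omega (boundary Omega) psi) => //.
by move=> x [].
Qed.
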